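(* Let $L$ be a transitive imprimitive permutation group of degree $6$ admitting no blocks of imprimitivity of size $3$. Let $\Gamma$ be a connected cubic graph, let $M$ be the $\mathbb F_2$-nullspace of $\Gamma$ and suppose that $M$ is non-trivial. Suppose further that $\mathrm{Aut}(\Gamma)$ contains subgroups $H\le G$ such that $H$ acts regularly on the set of arcs of $\Gamma$ and $G$ acts regularly on the set of $2$-arcs of $\Gamma$. Let $\Lambda=\Gamma[2K_1]$. Then there exists an arc-transitive subgroup $C\le\mathrm{Aut}(\Lambda)$ such that the pair $(\Lambda,C)$ is locally-$L$ and the stabiliser in $C$ of an arc of $\Lambda$ has order $|M||L|/48\ge|M|/4$.
   Context: Graphs are finite, simple and connected. A $2$-arc is a walk $(x,y,z)$ with $x\sim y\sim z$, $x\ne z$. For a graph $\Gamma$ with vertex-set $V$, the $\mathbb F_2$-nullspace of $\Gamma$ is the set of functions $x:V\to\mathbb F_2$ such that $\sum_{u\in\Gamma(v)}x(u)=0$ for every $v\in V$ (a vector subspace of $\mathbb F_2^V$); $|M|$ denotes its number of elements. $\Gamma[2K_1]$ is the lexicographic product of $\Gamma$ with the edgeless graph on two vertices: vertex-set $\mathbb F_2\times V$, with $(a,v)$ adjacent to $(b,w)$ iff $v$ and $w$ are adjacent in $\Gamma$. A pair $(\Lambda,C)$ with $C\le\mathrm{Aut}(\Lambda)$ is locally-$L$ if $C$ is transitive on the arcs of $\Lambda$ and the permutation group induced by the vertex-stabiliser $C_v$ on the neighbourhood $\Lambda(v)$ is permutation isomorphic to $L$. *)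

(* Defs.v *)
From HB Require Import structures.
From mathcomp Require Import all_boot all_order all_algebra all_fingroup all_solvable.

Set Implicit Arguments.
Unset Strict Implicit.
Unset Printing Implicit Defensive.

Import GroupScope.

Record sgraph := SGraph {
  vertex :> finType;
  adj : rel vertex;
  adj_sym : symmetric adj;
  adj_irr : irreflexive adj
}.

Definition nbhd (Gam : sgraph) (v : Gam) : {set Gam} := [set u | adj v u].

Definition connected (Gam : sgraph) : Prop :=
  (0 < #|Gam|)%N /\ forall x y : Gam, connect (@adj Gam) x y.

Definition cubic (Gam : sgraph) : Prop := forall v : Gam, #|nbhd v| = 3.

Definition graph_aut (Gam : sgraph) : {set {perm Gam}} :=
  [set s : {perm Gam} | [forall x, forall y, adj (s x) (s y) == adj x y]].

Lemma graph_aut_group_set (Gam : sgraph) : group_set (graph_aut Gam).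
Proof.
apply/group_setP; split=> [|s t].
  by rewrite inE; apply/'forall_forallP=> x y; rewrite !perm1.
rewrite !inE => /'forall_forallP hs /'forall_forallP ht.
apply/'forall_forallP=> x y; rewrite !permM.
by rewrite (eqP (ht _ _)) (eqP (hs _ _)).
Qed.

Canonical graph_aut_group (Gam : sgraph) := Group (graph_aut_group_set Gam).

(* Arcs and 2-arcs are tuples of vertices, so that permutations act on them   *)
(* coordinatewise through the library actions 'P * 2 and 'P * 3.              *)
Definition arcs (Gam : sgraph) : {set 2.-tuple Gam} :=
  [set t : 2.-tuple Gam | if tval t is [:: x; y] then adj x y else false].

Definition arcs2 (Gam : sgraph) : {set 3.-tuple Gam} :=
  [set t : 3.-tuple Gam |
     if tval t is [:: x; y; z] then [&& adj x y, adj y z & x != z] else false].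

Definition regular_on (aT : finGroupType) (sT : finType)
    (A : {set aT}) (S : {set sT}) (to : {action aT &-> sT}) : Prop :=
  [transitive A, on S | to] /\ {in S, forall x, 'C_A[x | to] = 1}.

Definition nullspace (Gam : sgraph) : {set {ffun Gam -> 'F_2}} :=
  [set x : {ffun Gam -> 'F_2} |
     [forall v, (\sum_(u in nbhd v) x u)%R == 0%R]].

Definition lex2_adj (Gam : sgraph) : rel ('F_2 * Gam) :=
  [rel p q | adj p.2 q.2].

Lemma lex2_adj_sym (Gam : sgraph) : symmetric (@lex2_adj Gam).
Proof. by move=> p q; apply: adj_sym. Qed.

Lemma lex2_adj_irr (Gam : sgraph) : irreflexive (@lex2_adj Gam).
Proof. by move=> p; apply: adj_irr. Qed.

(* The lexicographic product Gam[2K_1]. *)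
Definition lex2 (Gam : sgraph) : sgraph :=
  SGraph (@lex2_adj_sym Gam) (@lex2_adj_irr Gam).

Definition block (X : finType) (L : {set {perm X}}) (B : {set X}) : Prop :=
  B != set0 /\
  {in L, forall g : {perm X}, g @: B = B \/ [disjoint g @: B & B]}.

(* A and B are regarded as permutation groups on S and R respectively. *)
Definition perm_isomorphic (X Y : finType)
    (A : {set {perm X}}) (S : {set X}) (B : {set {perm Y}}) (R : {set Y}) : Prop :=
  exists (f : X -> Y) (phi : {perm X} -> {perm Y}),
    [/\ {in S &, injective f}, f @: S = R, misom A B phi &
        {in S & A, forall x (a : {perm X}), f (a x) = phi a (f x)}].

(* The permutation group induced on the neighbourhood of v by the stabiliser  *)
(* of v in C; restr_perm S s agrees with s on S and is the identity off S.    *)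
Definition local_group (Gam : sgraph) (C : {set {perm Gam}}) (v : Gam) :
    {set {perm Gam}} :=
  restr_perm (nbhd v) @* 'C_C[v | 'P].

Definition arc_transitive (Gam : sgraph) (C : {set {perm Gam}}) : Prop :=
  [transitive C, on arcs Gam | 'P * 2].

Definition locally (X : finType) (L : {set {perm X}})
    (Gam : sgraph) (C : {set {perm Gam}}) : Prop :=
  [/\ C \subset graph_aut Gam, arc_transitive C &
      forall v : Gam, perm_isomorphic L [set: X] (local_group C v) (nbhd v)].

(* Main.v *)
Require Import Defs.
From HB Require Import structures.
From mathcomp Require Import all_boot all_order all_algebra all_fingroup all_solvable.

Set Implicit Arguments.
Unset Strict Implicit.
Unset Printing Implicit Defensive.

Import GroupScope.

(* The group L preserves three blocks of size 2, so it lies in C_2 wr S_3. There,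
   an element of order 3 generates a non-normal subgroup of L (its orbits would
   otherwise be blocks of size 3), which forces L to contain the kernel, of order
   12, of the epimorphism (k, p) |-> (sum of k, sign of p) onto C_2 x C_2. Hence
   L is the preimage of a subgroup S of C_2 x C_2. The same epimorphism exists
   globally: let the pairs (x, g), with g in G and x : V -> F_2 having the same
   sum on all neighbourhoods, act on Gam[2K_1], and send (x, g) to
   (common sum of x, [g notin H]). Then C is the preimage of S. An element of G_v
   lies in H iff it is even on Gam(v), so the local action of C is the preimage
   of S in C_2 wr S_3, that is L. *)

(** * Transport of permutations along an injection *)

Section EmbedPerm.

Variables (X Y : finType) (f : X -> Y).
Hypothesis injf : injective f.

(** Points off the image of [f] stay fixed, the same convention as in [restr_perm]; this makes
    [emb_perm] comparable with elements of a local group. *)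
Definition emb_fun (s : {perm X}) (y : Y) : Y :=
  if [pick x | f x == y] is Some x then f (s x) else y.

Lemma emb_funE s x : emb_fun s (f x) = f (s x).
Proof.
rewrite /emb_fun; case: pickP => [z /eqP/injf -> //|/(_ x)].
by rewrite eqxx.
Qed.

Lemma emb_fun_out s y : y \notin codom f -> emb_fun s y = y.
Proof.
rewrite /emb_fun; case: pickP => // x /eqP <-.
by rewrite codom_f.
Qed.

Lemma emb_fun_inj s : injective (emb_fun s).
Proof.
move=> y z; have [/codomP[x ->]|yf] := boolP (y \in codom f);
  have [/codomP[x' ->]|zf] := boolP (z \in codom f).
- by rewrite !emb_funE => /injf/perm_inj ->.
- rewrite emb_funE (emb_fun_out s zf) => zE.
  by rewrite -zE codom_f in zf.
- rewrite emb_funE (emb_fun_out s yf) => yE.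
  by rewrite yE codom_f in yf.
- by rewrite !emb_fun_out.
Qed.

Definition emb_perm s : {perm Y} := perm (@emb_fun_inj s).

Lemma emb_permE s x : emb_perm s (f x) = f (s x).
Proof. by rewrite permE emb_funE. Qed.

Lemma emb_perm_out s y : y \notin codom f -> emb_perm s y = y.
Proof. by rewrite permE; apply: emb_fun_out. Qed.

Lemma emb_permM : {morph emb_perm : s t / s * t}.
Proof.
move=> s t; apply/permP => y; rewrite permM.
have [/codomP[x ->]|yf] := boolP (y \in codom f).
  by rewrite !emb_permE permM.
by rewrite !emb_perm_out.
Qed.

Lemma emb_perm_inj : injective emb_perm.
Proof.
move=> s t E; apply/permP => x; apply: injf.
by rewrite -!emb_permE E.
Qed.

Canonical emb_perm_morphism := @Morphism _ _ setT emb_perm (in2W emb_permM).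

Lemma injm_emb_perm : 'injm emb_perm.
Proof. by apply/injmP => s t _ _; apply: emb_perm_inj. Qed.

End EmbedPerm.

(** If [c] acts on the image of [f] as [l] acts on [X], then [restr_perm (nbhd v) c] is
    [emb_perm injf l]. Lifting in both directions thus makes [emb_perm] itself the isomorphism. *)
Lemma local_group_isomorphic (X : finType) (L : {group {perm X}}) (Gam : sgraph)
    (C : {group {perm Gam}}) (v : Gam) (f : X -> Gam) :
  injective f -> f @: [set: X] = nbhd v ->
  (forall l, l \in L -> exists2 c, c \in 'C_C[v | 'P] &
     forall x, c (f x) = f (l x)) ->
  (forall c, c \in 'C_C[v | 'P] -> exists2 l, l \in L &
     forall x, c (f x) = f (l x)) ->
  perm_isomorphic L [set: X] (local_group C v) (nbhd v).
Proof.
move=> injf imf LC CL; pose phi := emb_perm injf.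
have fN x : f x \in nbhd v by rewrite -imf imset_f.
have fNP y : y \in nbhd v -> exists x, y = f x.
  by rewrite -imf => /imsetP[x _ ->]; exists x.
have NC c : c \in 'C_C[v | 'P] -> c \in 'N(nbhd v | 'P).
  move=> /CL[l _ cf]; rewrite !inE; apply/subsetP => _ /fNP[x ->].
  by rewrite inE /= /aperm cf.
have restrE c (l : {perm X}) : c \in 'C_C[v | 'P] -> (forall x, c (f x) = f (l x)) ->
    restr_perm (nbhd v) c = phi l.
  move=> Cc cf; apply/permP => y.
  have [/fNP[x ->]|yN] := boolP (y \in nbhd v).
    by rewrite restr_permE ?NC // emb_permE cf.
  rewrite (out_perm (restr_perm_on _ _) yN) emb_perm_out //.
  by apply: contra yN => /codomP[x ->].
exists f, phi; split=> //.
- exact: in2W.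
- apply/andP; split; first by apply/morphicP => s t _ _; apply: emb_permM.
  have phi1 s : (phi s == 1) = (s == 1).
    rewrite -(morph1 (emb_perm_morphism injf)).
    by rewrite (inj_eq (@emb_perm_inj _ _ _ injf)).
  apply/eqP/setP => s; apply/imsetP/setD1P.
    case=> l /setD1P[l1 Ll] ->; rewrite phi1; split=> //.
    have [c Cc cf] := LC l Ll; rewrite -(restrE c l Cc cf).
    by rewrite mem_morphim // NC.
  case=> s1 /morphimP[c _ Cc sE]; have [l Ll cf] := CL c Cc.
  move: s1; rewrite sE /= (restrE c l Cc cf : _ = _) phi1 => l1.
  by exists l => //; rewrite !inE l1.
- by move=> x l _ _; rewrite emb_permE.
Qed.

(** * The wreath product of ['F_2] with a symmetric group, acting on pairs *)

Section Wreath.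

Variable T : finType.

(** The shift is read at the point before [g] moves it, whence the twist [ffact y g] in [wrM]. The
    formula serves [L], with [T] the three blocks, and also the lifted group, with [T] the
    vertices. *)
Definition wr_fun (x : {ffun T -> 'F_2}) (g : {perm T}) (q : 'F_2 * T) : 'F_2 * T :=
  ((q.1 + x q.2)%R, g q.2).

Lemma wr_fun_inj x g : injective (wr_fun x g).
Proof.
case=> [a s] [b t] /eqP; rewrite xpair_eqE /= => /andP[/eqP + /eqP/perm_inj st].
by rewrite st => /GRing.addIr ->.
Qed.

Definition wr x g : {perm 'F_2 * T} := perm (@wr_fun_inj x g).

Lemma wrE x g a t : wr x g (a, t) = ((a + x t)%R, g t).
Proof. by rewrite permE. Qed.

Lemma wr1 : 1 = wr 0%R 1.
Proof. by apply/permP => -[a t]; rewrite wrE !perm1 ffunE GRing.addr0. Qed.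

Definition ffact (x : {ffun T -> 'F_2}) (g : {perm T}) : {ffun T -> 'F_2} :=
  [ffun t => x (g t)].

Lemma wrM x y g h : wr x g * wr y h = wr (x + ffact y g)%R (g * h).
Proof.
apply/permP => -[a t]; rewrite permM !wrE permM !ffunE.
by rewrite GRing.addrA.
Qed.

Lemma wr_inj x y g h : wr x g = wr y h -> x = y /\ g = h.
Proof.
move=> E; have H t : (x t, g t) = (y t, h t).
  by have := congr1 (fun c : {perm _} => c (0%R, t)) E; rewrite !wrE !GRing.add0r.
split; first by apply/ffunP => t; case: (H t).
by apply/permP => t; case: (H t).
Qed.

Lemma addF2 (a : 'F_2) : (a + a = 0)%R.
Proof.
by rewrite -GRing.mulr2n -GRing.mulr_natr (GRing.pcharf0 (pchar_Fp (isT : prime 2)))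
  GRing.mulr0.
Qed.

Lemma addF2ffun (x : {ffun T -> 'F_2}) : (x + x = 0)%R.
Proof. by apply/ffunP => t; rewrite !ffunE addF2. Qed.

Lemma sum_ffact x g : (\sum_t ffact x g t = \sum_t x t)%R.
Proof.
rewrite [RHS](reindex_inj (@perm_inj _ g)).
by apply: eq_bigr => t _; rewrite ffunE.
Qed.

Lemma wrV k p :
  (wr k p)^-1 = wr (ffact k p^-1) p^-1.
Proof.
apply/eqP; rewrite eq_invg_mul wrM wr1; apply/eqP; congr wr; last by rewrite mulgV.
by apply/ffunP => t; rewrite !ffunE permK addF2.
Qed.

Lemma wrJ1 e h q :
  wr e 1 ^ wr h q = wr (ffact e q^-1) 1.
Proof.
rewrite /conjg wrV !wrM mul1g mulVg; congr wr; apply/ffunP => t.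
by rewrite !ffunE perm1 GRing.addrCA addF2 GRing.addr0.
Qed.

End Wreath.

Lemma F2P (a : 'F_2) : a = 0%R \/ a = 1%R.
Proof. by case: a => [[|[|]] //] i; [left|right]; apply: val_inj. Qed.

(** * Parity of permutations of three points *)

Section DegreeThree.

Variable T : finType.
Hypothesis T3 : #|T| = 3.

Lemma card3_exhaust (i j k x : T) :
  i != j -> i != k -> j != k -> [|| x == i, x == j | x == k].
Proof.
move=> ij ik jk; have /eqP : [set i; j; k] == setT.
  rewrite eqEcard subsetT cardsT T3 setUC cardsU1 cards2 !inE ij.
  by rewrite !(eq_sym k) negb_or ik jk.
by move/setP/(_ x); rewrite !inE -orbA.
Qed.

(** Only the transposition of the two other points remains. *)
Lemma perm3_fix_odd (p : {perm T}) i : p i = i -> p != 1 -> p.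
Proof.
move=> pi p1; have [j pj] : exists j, p j != j.
  apply/existsP; apply: contraR p1; rewrite negb_exists => /forallP p1.
  by apply/eqP/permP => x; rewrite perm1; apply/eqP; rewrite -[_ == _]negbK.
have ij : i != j by apply: contraNneq pj => <-; rewrite pi.
have ipj : i != p j by rewrite -{1}pi (inj_eq perm_inj).
have jpj : j != p j by rewrite eq_sym.
suff -> : p = tperm j (p j) by rewrite odd_tperm.
apply/permP => x; case/or3P: (card3_exhaust x ij ipj jpj) => /eqP ->.
- by rewrite tpermD // eq_sym.
- by rewrite tpermL.
rewrite tpermR; case/or3P: (card3_exhaust (p (p j)) ij ipj jpj) => /eqP // E.
  by move: E ipj; rewrite -{1}pi => /perm_inj ->; rewrite eqxx.
by move/perm_inj: E pj => ->; rewrite eqxx.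
Qed.

(** Composing [p] with the transposition of [i] and [p i] fixes [i]. The product is not the
    identity, since a transposition would fix the third point; so it is odd and [p] is even. *)
Lemma perm3_free_even (p : {perm T}) : (forall i, p i != i) -> ~~ p.
Proof.
move=> pf; have /card_gt0P[i _] : 0 < #|T| by rewrite T3.
pose q := p * tperm i (p i).
have qi : q i = i by rewrite permM tpermR.
have oq : q.
  apply: (perm3_fix_odd qi); apply/eqP => q1.
  have pE : p = tperm i (p i).
    by rewrite -[RHS]mul1g -q1 /q -mulgA tperm2 mulg1.
  have := cardsC [set i; p i]; rewrite T3 cards2 eq_sym pf.
  move=> /eqP; rewrite -[3]/(2 + 1)%N eqn_add2l => /cards1P[k kE].
  have : k \in ~: [set i; p i] by rewrite kE set11.
  rewrite !inE negb_or => /andP[ki kpi].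
  by have := pf k; rewrite pE tpermD ?eqxx // eq_sym.
by move: oq; rewrite odd_permM odd_tperm eq_sym pf addbT.
Qed.

Lemma card3_Alt : #|'Alt_T| = 3.
Proof.
have := @card_Alt T; rewrite T3 => /(_ isT) /eqP.
by rewrite (_ : 3`! = 2 * 3)%N // eqn_pmul2l // => /eqP.
Qed.

(** The even permutations form a group of prime order 3, generated by any non-identity member. *)
Lemma perm3_even_cycle (p q : {perm T}) :
  ~~ p -> p != 1 -> ~~ q -> q \in <[p]>.
Proof.
move=> ep p1 eq; suff -> : <[p]> = 'Alt_T by rewrite Alt_even.
apply/eqP; rewrite eqEcard cycle_subG Alt_even ep card3_Alt /= -orderE.
have : #[p] %| 3 by rewrite -card3_Alt order_dvdG // Alt_even.
rewrite dvdn_divisors // => /predU1P[/eqP|/predU1P[->|]] //.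
by rewrite order_eq1 (negPf p1).
Qed.

End DegreeThree.

Arguments odd_perm {T} s.

(** This count gives both the order of [L] and the order of the lifted group. *)
Lemma card_fibre_pairs (A B : finType) (XA : {set A}) (XB : {set B})
    (D1 : A -> 'F_2) (D2 : B -> bool) (S : {set 'F_2 * bool}) n m :
    (forall a, #|[set x in XA | D1 x == a]| = n) ->
    (forall b, #|[set y in XB | D2 y == b]| = m) ->
  #|[set q | [&& q.1 \in XA, q.2 \in XB & (D1 q.1, D2 q.2) \in S]]|
    = (n * m * #|S|)%N.
Proof.
move=> cA cB; pose D (q : A * B) := (D1 q.1, D2 q.2).
rewrite -sum1_card (partition_big D (mem S)); last first.
  by move=> q; rewrite inE => /and3P[].
rewrite mulnC -sum_nat_const; apply: eq_bigr => -[a b] Sab.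
rewrite sum1_card -(cA a) -(cB b) -cardsX; apply: eq_card => -[x y].
rewrite !inE unfold_in /= !inE /D /= xpair_eqE.
case: (D1 x =P a) => [->|]; case: (D2 y =P b) => [->|]; rewrite ?andbT ?andbF //.
by rewrite (Sab : (a, b) \in S) andbT.
Qed.

(** Elements normalising [<[t]>] permute its orbits, and distinct orbits are disjoint. *)
Lemma cycle_orbit_block (T : finType) (L : {group {perm T}}) (t : {perm T}) y :
  L \subset 'N(<[t]>) -> block L (orbit 'P <[t]> y).
Proof.
move=> nL; split; first by apply/set0Pn; exists y; apply: orbit_refl.
move=> g Lg; set B := orbit _ _ _.
have [|] := boolP [disjoint g @: B & B]; first by right.
rewrite -setI_eq0 => /set0Pn[z /setIP[]].
case/imsetP => _ /orbitP[s ts <-] zE /orbitP[s' ts' zE'].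
left; apply/eqP; rewrite eqEcard (card_imset _ perm_inj) leqnn andbT.
apply/subsetP => _ /imsetP[_ /orbitP[s2 ts2 <-] ->].
(* The factor [s'] takes [y] to [z], which is also [g (s y)]; the conjugate then takes [g (s y)] to
   [g (s2 y)]. *)
apply/orbitP; exists (s' * (s^-1 * s2) ^ g).
  rewrite groupM // memJ_norm ?(subsetP nL) //.
  by rewrite groupM ?groupV.
rewrite /= /aperm permM; move: zE'; rewrite /= /aperm => ->; rewrite zE /= /aperm.
by rewrite -!permM /conjg !mulgA mulgK mulgV mul1g.
Qed.

(** * Subgroups of the wreath product of degree 6 without blocks of size 3 *)

Section WreathDegreeThree.

Definition tot (k : {ffun 'I_3 -> 'F_2}) : 'F_2 := (\sum_i k i)%R.

Lemma totD k l : tot (k + l)%R = (tot k + tot l)%R.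
Proof. by rewrite /tot -big_split; apply: eq_bigr => i _; rewrite ffunE. Qed.

Lemma tot0 : tot 0%R = 0%R.
Proof. by rewrite /tot big1 // => i _; rewrite ffunE. Qed.

Lemma tot_ffact k p : tot (ffact k p) = tot k.
Proof. exact: sum_ffact. Qed.

(** Only the total of the shift matters later, so its exact value stays existential. *)
Lemma wrX_ex k p n : tot k = 0%R ->
  exists2 k', tot k' = 0%R & wr k p ^+ n = wr k' (p ^+ n).
Proof.
move=> k0; elim: n => [|n [k' k'0 IH]].
  by exists 0%R; [exact: tot0|rewrite !expg0 wr1].
exists (k + ffact k' p)%R; first by rewrite totD tot_ffact k0 k'0 GRing.addr0.
by rewrite !expgS IH wrM.
Qed.

Lemma wrJ_ex k p h q :
  exists2 k', tot k' = tot k & wr k p ^ wr h q = wr k' (p ^ q).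
Proof.
rewrite /conjg wrV !wrM; eexists; last reflexivity.
by rewrite !(totD, tot_ffact) GRing.addrCA addF2 GRing.addr0.
Qed.

Lemma totE k : tot k = (k ord0 + k (lift ord0 ord0) + k (lift ord0 (lift ord0 ord0)))%R.
Proof. by rewrite /tot !big_ord_recl big_ord0 GRing.addr0 GRing.addrA. Qed.

Lemma tot0_zero k : tot k = 0%R -> exists i, k i = 0%R.
Proof.
rewrite totE => k0.
case: (F2P (k ord0)) => [|k1]; first by exists ord0.
case: (F2P (k (lift ord0 ord0))) => [|k2]; first by exists (lift ord0 ord0).
exists (lift ord0 (lift ord0 ord0)).
by move: k0; rewrite k1 k2 addF2 GRing.add0r.
Qed.

Lemma ord3P (P : 'I_3 -> Prop) :
  P ord0 -> P (lift ord0 ord0) -> P (lift ord0 (lift ord0 ord0)) -> forall i, P i.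
Proof.
move=> P0 P1 P2 i; case: (unliftP ord0 i) => [j|] -> //.
case: (unliftP ord0 j) => [l|] -> //.
by rewrite (ord1 l).
Qed.

(** An even number of the three coordinates equal 1, so a non-zero [k] has exactly one zero. *)
Lemma tot0_support k j : tot k = 0%R -> k != 0%R -> k j = 0%R ->
  forall i, k i = ((i != j)%:R)%R.
Proof.
rewrite totE => k0 kn0 kj.
have kn : ~ forall i, k i = 0%R.
  by move=> k0'; case/eqP: kn0; apply/ffunP => i; rewrite k0' ffunE.
have {}kn : ~ [/\ k ord0 = 0%R, k (lift ord0 ord0) = 0%R
       & k (lift ord0 (lift ord0 ord0)) = 0%R].
  by case=> *; apply: kn; apply: ord3P.
move: k0 kj kn; case: (F2P (k ord0)) => H0; case: (F2P (k (lift ord0 ord0))) => H1;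
case: (F2P (k (lift ord0 (lift ord0 ord0)))) => H2; rewrite ?H0 ?H1 ?H2;
move: j; apply: ord3P; rewrite ?H0 ?H1 ?H2 // => _ _ kn;
try (by case: kn); by apply: ord3P; rewrite ?H0 ?H1 ?H2.
Qed.

Lemma tot0_eq k l j : tot k = 0%R -> tot l = 0%R -> k != 0%R -> l != 0%R ->
  k j = 0%R -> l j = 0%R -> k = l.
Proof.
move=> k0 l0 kn ln kj lj; apply/ffunP => i.
by rewrite (tot0_support k0 kn kj) (tot0_support l0 ln lj).
Qed.

Variable L : {group {perm 'F_2 * 'I_3}}.
Hypothesis trL : [transitive L, on setT | 'P].
Hypothesis wrL : forall l, l \in L -> exists k p, l = wr k p.
Hypothesis noblock3 : forall B, block L B -> #|B| <> 3.

(** Some conjugate of an element [t] of order 3 lies outside [<[t]>], and differs from a power of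
    [t] by a non-zero shift of total 0. Conjugating this shift by powers of [t] gives all such
    shifts; together with the powers of [t] they make up the kernel. *)
Lemma noblock_kernel k (p : 'S_3) : tot k = 0%R -> ~~ p -> wr k p \in L.
Proof.
have I3 : #|'I_3| = 3 by rewrite card_ord.
have d3 : 3 %| #|L|.
  apply: dvdn_trans (atrans_dvd trL).
  by rewrite cardsT card_prod I3 dvdn_mull.
have [t Lt ot] := Cauchy (isT : prime 3) d3.
have [kt [pt tE]] := wrL Lt.
have t3 : t ^+ 3 = 1 by have := expg_order t; rewrite ot.
(* Cubing triples the total, which leaves it unchanged modulo 2. *)
have {t3} [kt0 pt3] : tot kt = 0%R /\ pt ^+ 3 = 1.
  move: t3; rewrite tE 2!expgS expg1 !wrM wr1 => /wr_inj[kE pE].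
  split; last by rewrite 2!expgS expg1.
  move: kE => /(congr1 tot); rewrite !(totD, tot_ffact) addF2 GRing.addr0 => ->.
  exact: tot0.
have ept : ~~ pt.
  by have := congr1 (@odd_perm _) pt3; rewrite !expgS expg0 mulg1;
    rewrite !odd_permM odd_perm1; case: (odd_perm pt).
(* Otherwise [t] would be a pure shift, of order dividing 2. *)
have pt1 : pt != 1.
  apply/eqP => pt1; have : #[t] %| 2.
    by rewrite order_dvdn tE pt1 expgS expg1 wrM mulg1 wr1; apply/eqP; congr wr;
       apply/ffunP => i; rewrite !ffunE perm1 addF2.
  by rewrite ot.
have ptf i : pt i != i.
  by apply: contraNneq ept => /(perm3_fix_odd I3) /(_ pt1).
pose y0 : 'F_2 * 'I_3 := (0%R, ord0).
have card_orb : #|orbit 'P <[t]> y0| = 3.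
  have := dvdn_indexg <[t]> 'C_<[t]>[y0 | 'P]; rewrite -card_orbit -orderE ot.
  rewrite dvdn_divisors // => /predU1P[/card_orbit1 E|/predU1P[->|]] //.
  have : t y0 \in orbit 'P <[t]> y0 by apply/orbitP; exists t => //; apply: cycle_id.
  by rewrite E inE tE wrE xpair_eqE (negPf (ptf _)) andbF.
(* If [L] normalised [<[t]>], the orbit of [y0] would be a block of size 3. *)
have : ~~ (L \subset 'N(<[t]>)).
  by apply/negP => /(cycle_orbit_block y0)/noblock3.
case/subsetPn => g Lg; rewrite inE -cycleJ cycle_subG => tgt.
have [kg [pg gE]] := wrL Lg.
have [k' k'0 tgE] := wrJ_ex kt pt kg pg; rewrite kt0 -tE -gE in k'0 tgE.
have /cycleP[n pn] : pt ^ pg \in <[pt]>.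
  by apply: perm3_even_cycle; rewrite // odd_permJ.
have [kn kn0 tnE] := wrX_ex pt n kt0; rewrite -tE -pn in tnE.
(* [t ^ g] and [t ^+ n] act alike on the labels, so their quotient is a shift; it is non-zero
   because [t ^ g] is not a power of [t]. *)
have [e [e0 en0 Le]] : exists e, [/\ tot e = 0%R, e != 0%R & wr e 1 \in L].
  exists (k' + ffact (ffact kn (pt ^ pg)^-1) (pt ^ pg))%R.
  have sE : wr (k' + ffact (ffact kn (pt ^ pg)^-1) (pt ^ pg))%R 1 = t ^ g * (t ^+ n)^-1.
    by rewrite tgE tnE wrV wrM mulgV.
  split; first by rewrite totD !tot_ffact k'0 kn0 GRing.addr0.
    apply: contraNneq tgt => E; move: sE; rewrite E -wr1 => /esym/eqP.
    by rewrite -eq_mulgV1 => /eqP ->; rewrite mem_cycle.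
  by rewrite sE groupM ?groupV ?groupX ?groupJ.
have LE l : tot l = 0%R -> wr l 1 \in L.
  move=> l0; have [->|ln0] := eqVneq l 0%R; first by rewrite -wr1 group1.
  have [i ei] := tot0_zero e0; have [j lj] := tot0_zero l0.
  (* As [pt] is a 3-cycle, conjugation by a power of [t] carries the zero of [e] to the zero of [l],
     and the position of the zero determines the shift. *)
  have [m mE] : exists m, (pt ^+ m) i = j.
    have p2 : (pt ^+ 2) i != i.
      rewrite -(inj_eq (@perm_inj _ pt)) -permM -expgSr pt3 perm1 eq_sym.
      exact: ptf.
    have p21 : pt i != (pt ^+ 2) i by rewrite expgS expg1 permM eq_sym.
    have := card3_exhaust I3 j (_ : i != pt i) (_ : i != (pt ^+ 2) i) p21.
    rewrite ![i == _]eq_sym ptf p2 => /(_ isT isT) /or3P[] /eqP ->.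
    - by exists 0%N; rewrite perm1.
    - by exists 1%N.
    - by exists 2%N.
  have [km km0 tmE] := wrX_ex pt m kt0; rewrite -tE in tmE.
  have -> : wr l 1 = wr e 1 ^ (t ^+ m); last by rewrite groupJ ?groupX.
  rewrite tmE wrJ1; congr wr; apply: (@tot0_eq _ _ j) => //.
  - by rewrite tot_ffact.
  - apply: contraNneq en0 => /ffunP E; apply/eqP/ffunP => x.
    by have := E ((pt ^+ m) x); rewrite !ffunE permK.
  - by rewrite ffunE -mE permK.
move=> k0 ep; have /cycleP[m pm] := perm3_even_cycle I3 ept pt1 ep.
have [km km0 tmE] := wrX_ex pt m kt0; rewrite -tE -pm in tmE.
have -> : wr k p = wr (k + km)%R 1 * t ^+ m.
  rewrite tmE wrM mul1g; congr wr; apply/ffunP => i.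
  by rewrite !ffunE perm1 -GRing.addrA addF2 GRing.addr0.
by rewrite groupM ?groupX // LE // totD k0 km0 GRing.addr0.
Qed.

(** [S] is the image of [L] under total and sign. Since [L] contains the kernel, elements with the
    same image are in [L] together; each fibre has 4 shifts times 3 permutations. *)
Lemma noblock_classification : exists S : {set 'F_2 * bool},
  [/\ (0%R, false) \in S,
      forall a b c d, (a, c) \in S -> (b, d) \in S -> ((a + b)%R, c (+) d) \in S,
      forall k p, (wr k p \in L) = ((tot k, odd_perm p) \in S)
    & #|L| = (12 * #|S|)%N].
Proof.
pose S := [set s : 'F_2 * bool | [exists k, exists p,
    (wr k p \in L) && (s == (tot k, odd_perm p))]].
have memS k p : (wr k p \in L) = ((tot k, odd_perm p) \in S).
  apply/idP/idP; first rewrite inE => Lkp.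
    by apply/'exists_existsP; exists k, p; rewrite Lkp eqxx.
  rewrite inE => /'exists_existsP[k' [p' /andP[Lkp' /eqP[ek ep]]]].
  rewrite -(groupMr _ (groupVr Lkp')) wrV wrM; apply: noblock_kernel.
    by rewrite totD !tot_ffact -ek addF2.
  by rewrite odd_permM odd_permV -ep addbb.
have SP a c : (a, c) \in S -> exists k p, [/\ wr k p \in L, tot k = a & odd_perm p = c].
  by rewrite inE => /'exists_existsP[k [p /andP[Lkp /eqP[-> ->]]]]; exists k, p.
clearbody S; exists S; split=> //.
- have <- : (tot 0%R, odd_perm (1 : 'S_3)) = (0%R, false).
    by rewrite odd_perm1 tot0.
  by rewrite -memS -wr1 group1.
- move=> a b c d /SP[k [p [Lkp <- <-]]] /SP[k' [p' [Lkp' <- <-]]].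
  have := groupM Lkp Lkp'.
  by rewrite wrM memS totD tot_ffact odd_permM.
have cA a : #|[set k in [set: {ffun 'I_3 -> 'F_2}] | tot k == a]| = 4.
  pose one : {ffun 'I_3 -> 'F_2} := [ffun=> 1%R].
  pose F a := [set k in [set: {ffun 'I_3 -> 'F_2}] | tot k == a].
  have tot1 : tot one = 1%R by rewrite totE !ffunE addF2 GRing.add0r.
  (* Adding the all-one vector, whose total is 1, exchanges the two fibres. *)
  have le b : #|F b| <= #|F (b + 1)%R|.
    rewrite -(card_imset _ (@GRing.addIr _ one)); apply: subset_leq_card.
    apply/subsetP => _ /imsetP[k + ->]; rewrite !inE /= => /eqP <-.
    by rewrite totD tot1.
  have eqF b : #|F b| = #|F (b + 1)%R|.
    by apply/eqP; rewrite eqn_leq le (leq_trans (le _)) // -GRing.addrA addF2 GRing.addr0.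
  have FC : F (a + 1)%R = ~: F a.
    apply/setP => k; rewrite !inE; case: (F2P a) => ->; case: (F2P (tot k)) => -> //.
  have := cardsC (F a); rewrite -FC -eqF card_ffun card_Fp // card_ord addnn.
  by rewrite -[(2 ^ 3)%N]/(4.*2) => /double_inj.
have cB b : #|[set p in [set: 'S_3] | odd_perm p == b]| = 3.
  have eA : #|[set p in [set: 'S_3] | odd_perm p == false]| = 3.
    apply: etrans (@card3_Alt 'I_3 (card_ord 3)); apply: eq_card => p.
    by rewrite Alt_even !inE /= eqbF_neg.
  case: b => //; have := cardsC [set p in [set: 'S_3] | odd_perm p == false].
  rewrite eA card_Sn -[3`!]/(3 + 3)%N => /addnI E3.
  apply: etrans E3; apply: eq_card => p.
  by rewrite !inE /=; case: odd_perm.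
have := card_fibre_pairs S cA cB; rewrite -[(4 * 3)%N]/12 => <-.
rewrite -(@card_in_imset _ _ (fun q => wr q.1 q.2)); last first.
  by move=> [k p] [k' p'] _ _ /= /wr_inj[-> ->].
apply: eq_card => l; apply/idP/imsetP.
  move=> Ll; have [k [p lE]] := wrL Ll.
  by exists (k, p); rewrite //= !inE -memS -lE.
by case=> -[k p]; rewrite !inE /= -memS => Lkp ->.
Qed.

End WreathDegreeThree.

(** * Coordinates for an imprimitive group of degree 6 *)

Section ImprimitiveDegreeSix.

Variables (Omega : finType) (L : {group {perm Omega}}).
Hypothesis degL : #|Omega| = 6.
Hypothesis transL : [transitive L, on [set: Omega] | 'P].
Hypothesis imprimL : ~~ [primitive L, on [set: Omega] | 'P].
Hypothesis noblock3 : forall B : {set Omega}, block L B -> #|B| <> 3.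

(** By transitivity the parts of an invariant partition are blocks of equal size. This size divides
    6, is neither 1 nor 6 for a non-trivial system, and is not 3. *)
Lemma pair_block_system : exists Q : {set {set Omega}},
  [/\ partition Q setT, #|Q| = 3, {in Q, forall B : {set Omega}, #|B| = 2}
    & {in L & Q, forall (l : {perm Omega}) (B : {set Omega}), l @: B \in Q}].
Proof.
move: imprimL; rewrite /primitive transL negbK => /existsP[Q /and3P[pQ aQ cQ]].
have imQ : {in L & Q, forall (l : {perm Omega}) (B : {set Omega}), l @: B \in Q}.
  by move=> l B Ll QB; have := actsP aQ l Ll B; rewrite QB.
have [/eqP covQ tiQ nQ0] := and3P pQ.
have eqQ B B' x : B \in Q -> B' \in Q -> x \in B -> x \in B' -> B = B'.
  by move=> QB QB' xB xB'; rewrite -(def_pblock tiQ QB xB) (def_pblock tiQ QB' xB').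
have /card_gt0P[B0 QB0] : 0 < #|Q| by case/andP: cQ => /ltnW.
have neQ B : B \in Q -> exists x, x \in B.
  by move=> QB; apply/set0Pn; apply: contraNneq nQ0 => <-.
have cB B : B \in Q -> #|B| = #|B0|.
  move=> QB; have [x xB] := neQ B QB; have [y yB0] := neQ B0 QB0.
  have [l Ll xE] := atransP2 transL (in_setT y) (in_setT x).
  have -> : B = l @: B0.
    by apply: (eqQ _ _ x); rewrite ?imQ // xE; exact: (imset_f l yB0).
  exact: card_imset perm_inj.
have bB : block L B0.
  split; first by apply/set0Pn; apply: neQ.
  move=> l Ll; have [|] := boolP [disjoint l @: B0 & B0]; first by right.
  rewrite -setI_eq0 => /set0Pn[z /setIP[z1 z2]]; left.
  by apply: eqQ z1 z2 => //; apply: imQ.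
have := card_uniform_partition cB pQ; rewrite cardsT degL => c6.
have /eqP n3 := noblock3 bB.
move: cQ; rewrite cardsT degL => cQ.
have [q3 b2] : #|Q| = 3 /\ #|B0| = 2.
  move: c6 cQ n3; case: #|Q| => [|[|[|[|[|[|q]]]]]] //;
  by case: #|B0| => [|[|[|[|[|[|[|b]]]]]]] //; rewrite ?mulnS.
by exists Q; split=> // B QB; rewrite cB.
Qed.

(** The second coordinate numbers the three blocks; the first is 0 at a chosen representative of the
    block and 1 at its other point. *)
Lemma imprimitive_coordinates : exists2 e : Omega -> 'F_2 * 'I_3, injective e &
  forall l, l \in L -> exists k p, forall w, e (l w) = wr k p (e w).
Proof.
have [Q [pQ q3 b2 imQ]] := pair_block_system.
have [/eqP covQ tiQ nQ0] := and3P pQ.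
have /card_gt0P[w0 _] : 0 < #|Omega| by rewrite degL.
pose blk w := pblock Q w.
have blkQ w : blk w \in Q by rewrite pblock_mem // covQ inE.
have wblk w : w \in blk w by rewrite mem_pblock covQ inE.
have blkE B w : B \in Q -> w \in B -> blk w = B by apply: def_pblock.
pose r (B : {set Omega}) : 'I_3 := inord (index B (enum Q)).
have rinj : {in Q &, injective r}.
  have ltQ B : B \in Q -> index B (enum Q) < 3.
    by move=> QB; rewrite -q3 cardE index_mem mem_enum.
  move=> B B' QB QB' /(congr1 val).
  rewrite /= (inordK (ltQ B QB)) (inordK (ltQ B' QB')).
  by apply: index_inj; rewrite ?mem_enum.
(* The default [w0] is never reached on members of [Q], which have two points. *)
pose rep (B : {set Omega}) := odflt w0 [pick x in B].
have repB B : B \in Q -> rep B \in B.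
  move=> QB; rewrite /rep; case: pickP => // B0.
  by have := b2 B QB; rewrite (eq_card0 B0).
pose e w : 'F_2 * 'I_3 := (((w != rep (blk w))%:R)%R, r (blk w)).
have e_inj : injective e.
  move=> x y /eqP; rewrite xpair_eqE => /andP[/eqP xy /eqP/rinj bxy].
  have {}bxy : blk x = blk y by apply: bxy.
  have {}xy : (x == rep (blk x)) = (y == rep (blk x)).
    by move: xy; rewrite -bxy; do 2!case: eqP.
  case: (eqVneq x (rep (blk x))) xy => [<- /esym/eqP //|xr /esym/negbT yr].
  have := cardsD1 (rep (blk x)) (blk x); rewrite repB // b2 // => -[].
  move=> /esym/eqP/cards1P[z zE].
  have : x \in [set z] by rewrite -zE !inE xr wblk.
  have : y \in [set z] by rewrite -zE !inE yr bxy wblk.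
  by rewrite !inE => /eqP -> /eqP ->.
have [e' eK e'K] : bijective e.
  by apply: inj_card_bij => //; rewrite card_prod card_Fp // card_ord degL.
have blkL l x y : l \in L -> blk x = blk y -> blk (l x) = blk (l y).
  move=> Ll bxy; suff bl z : blk z = blk y -> blk (l z) = l @: blk y by rewrite !bl.
  by move=> bz; apply: blkE; [apply: imQ | apply: imset_f; rewrite -bz].
have e2blk x y : (e x).2 = (e y).2 -> blk x = blk y by move/rinj; apply.
exists e => // l Ll.
(* Both the block permutation and the shift are read off at the representatives. *)
pose pf i := (e (l (e' (0%R, i)))).2.
have pf_inj : injective pf.
  move=> i j /e2blk bij.
  have := blkL l^-1 _ _ (groupVr Ll) bij; rewrite !permK => /(congr1 r).
  by rewrite -[r _]/((e _).2) -[r (blk (e' (0%R, j)))]/((e _).2) !e'K.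
pose k : {ffun 'I_3 -> 'F_2} := [ffun i => (e (l (e' (0%R, i)))).1].
exists k, (perm pf_inj) => w.
case ew : (e w) => [a i]; rewrite wrE permE ffunE.
have wE : w = e' (a, i) by rewrite -ew eK.
have e2 : (e (l w)).2 = pf i.
  by congr r; apply: blkL => //; apply: e2blk; rewrite e'K ew.
rewrite [LHS]surjective_pairing e2; congr pair.
case: (F2P a) => a0; first by rewrite wE a0 GRing.add0r.
(* The two points of a block have distinct images in one block, so the second image carries the
   opposite bit. *)
have : (e (l w)).1 != (e (l (e' (0%R, i)))).1.
  apply/eqP => e1; have /e_inj/perm_inj we : e (l w) = e (l (e' (0%R, i))).
    by rewrite [LHS]surjective_pairing e1 e2 -surjective_pairing.
  by have := ew; rewrite we e'K a0.
rewrite a0; move: (e (l w)).1 (e (l (e' (0%R, i)))).1 => x y.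
by case: (F2P x) (F2P y) => -> [] ->; rewrite ?eqxx ?addF2 ?GRing.addr0.
Qed.

(** The coordinate bijection carries transitivity and the absence of blocks of size 3 over to the
    image [L'] of [L], to which [noblock_classification] applies. *)
Lemma imprimitive_classification :
  exists (e : Omega -> 'F_2 * 'I_3) (S : {set 'F_2 * bool}),
  [/\ bijective e, (0%R, false) \in S,
      forall a b c d, (a, c) \in S -> (b, d) \in S -> ((a + b)%R, c (+) d) \in S,
      [/\ forall l, l \in L -> exists k (p : 'S_3),
            (tot k, odd_perm p) \in S /\ forall w, e (l w) = wr k p (e w)
        & forall k (p : 'S_3), (tot k, odd_perm p) \in S ->
            exists2 l, l \in L & forall w, e (l w) = wr k p (e w)]
    & #|L| = (12 * #|S|)%N].
Proof.
have [e e_inj wrL] := imprimitive_coordinates.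
have [e' eK e'K] : bijective e.
  by apply: inj_card_bij => //; rewrite card_prod card_Fp // card_ord degL.
pose phi := emb_perm_morphism e_inj.
have phiE l w : phi l (e w) = e (l w) by exact: emb_permE.
pose L' := [group of phi @* L].
have L'P s : reflect (exists2 l, l \in L & s = phi l) (s \in L').
  apply: (iffP morphimP) => [[l _ Ll ->]|[l Ll ->]]; first by exists l.
  by exists l; rewrite ?inE.
have phi_wr (l : {perm Omega}) k p : (forall w, e (l w) = wr k p (e w)) <-> phi l = wr k p.
  split=> [lE|lE w]; last by rewrite -phiE lE.
  by apply/permP => y; rewrite -(e'K y) phiE lE.
have trL' : [transitive L', on setT | 'P].
  apply/imsetP; exists (e (e' (0%R, ord0))); first by rewrite inE.
  apply/setP => y; rewrite inE; apply/esym/orbitP.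
  have [l Ll yE] := atransP2 transL (in_setT (e' (0%R, ord0))) (in_setT (e' y)).
  exists (phi l); first by apply/L'P; exists l.
  by move: yE; rewrite /= /aperm phiE => <-; rewrite e'K.
have wrL' s : s \in L' -> exists k p, s = wr k p.
  by case/L'P=> l /wrL[k [p /phi_wr lE]] ->; exists k, p.
have nb3 B : block L' B -> #|B| <> 3.
  move=> [Bn0 BL']; have BE : e @: (e' @: B) = B.
    by rewrite -imset_comp (eq_imset _ e'K) imset_id.
  have e'_inj : injective e' by apply: can_inj e'K.
  have lB (l : {perm Omega}) : l @: (e' @: B) = e' @: (phi l @: B).
    rewrite -!imset_comp; apply: eq_imset => y /=.
    by rewrite -{2}(e'K y) phiE eK.
  rewrite -(card_imset _ e'_inj); apply: noblock3; split.
    by case/set0Pn: Bn0 => y By; apply/set0Pn; exists (e' y); rewrite imset_f.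
  move=> l Ll; rewrite lB; have /BL'[->|dB] : phi l \in L' by apply/L'P; exists l.
    by left.
  by right; rewrite -setI_eq0 -imsetI ?(disjoint_setI0 dB) ?imset0 //; apply: in2W.
have [S [S0 SD SP cS]] := noblock_classification trL' wrL' nb3.
exists e, S; split=> //; first by exists e'.
  split=> [l Ll|k p].
    have [k [p lE]] := wrL l Ll; exists k, p; split=> //.
    by rewrite -SP; apply/L'P; exists l => //; apply/esym/phi_wr.
  by rewrite -SP => /L'P[l Ll /esym/phi_wr lE]; exists l.
rewrite -cS; apply/esym; rewrite /= card_injm ?subsetT //.
exact: injm_emb_perm.
Qed.

End ImprimitiveDegreeSix.

(** * Neighbourhood sums and automorphisms of a cubic graph *)

Definition nsum (Gam : sgraph) (x : {ffun Gam -> 'F_2}) (v : Gam) : 'F_2 :=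
  (\sum_(u in nbhd v) x u)%R.

Lemma nsumD (Gam : sgraph) (x y : {ffun Gam -> 'F_2}) v :
  nsum (x + y)%R v = (nsum x v + nsum y v)%R.
Proof. by rewrite /nsum -big_split; apply: eq_bigr => u _; rewrite ffunE. Qed.

Lemma nullspaceP (Gam : sgraph) (x : {ffun Gam -> 'F_2}) :
  reflect (forall v, nsum x v = 0%R) (x \in nullspace Gam).
Proof. by rewrite inE; apply: (iffP forallP) => H v; apply/eqP/H. Qed.

Lemma graph_autP (Gam : sgraph) (g : {perm Gam}) : g \in graph_aut Gam ->
  forall x y, adj (g x) (g y) = adj x y.
Proof. by rewrite inE => /'forall_forallP H x y; apply/eqP/H. Qed.

Section CubicGraph.

Variables (Gam : sgraph) (cubicGam : cubic Gam).

Implicit Types (v u w : Gam) (b : 'I_3 -> Gam).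

(** A labelling of the neighbours of [v], through which the stabiliser of [v] acts as a subgroup of
    ['S_3]. *)
Definition nbhd_frame v b :=
  injective b /\ forall u, adj v u = (u \in codom b).

Lemma nbhd_frame_ex v : exists b, nbhd_frame v b.
Proof.
pose b (i : 'I_3) := enum_val (cast_ord (esym (cubicGam v)) i).
exists b; split=> [i j /enum_val_inj/cast_ord_inj //|u].
apply/idP/codomP => [vu|[i ->]]; last first.
  by have := enum_valP (cast_ord (esym (cubicGam v)) i); rewrite inE.
have Nu : u \in nbhd v by rewrite inE.
exists (cast_ord (cubicGam v) (enum_rank_in Nu u)).
by rewrite /b cast_ordK enum_rankK_in.
Qed.

Lemma frame_adj v b i : nbhd_frame v b -> adj v (b i).
Proof. by case=> _ ->; apply: codom_f. Qed.

Lemma frameP v b u : nbhd_frame v b -> adj v u -> exists i, u = b i.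
Proof. by case=> _ -> /codomP. Qed.

Lemma nsum_frame v b x : nbhd_frame v b -> nsum x v = (\sum_i x (b i))%R.
Proof.
move=> fr; have [b_inj _] := fr.
rewrite /nsum (_ : nbhd v = b @: setT); last first.
  apply/setP => u; rewrite inE; apply/idP/imsetP => [/(frameP fr)[i ->]|[i _ ->]].
    by exists i.
  exact: frame_adj.
rewrite big_imset; last by apply: in2W.
by apply: eq_bigl => i; rewrite inE.
Qed.

(** The valency is odd, so constants provide functions with common sum 1. *)
Lemma nsum_const v (a : 'F_2) : nsum [ffun=> a] v = a.
Proof.
have [b fr] := nbhd_frame_ex v; rewrite (nsum_frame _ fr).
under eq_bigr do rewrite ffunE.
by rewrite !big_ord_recl big_ord0 GRing.addr0 addF2 GRing.addr0.
Qed.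

Lemma frame_perm g v b : g \in graph_aut Gam -> g v = v -> nbhd_frame v b ->
  exists p : 'S_3, forall i, g (b i) = b (p i).
Proof.
move=> /graph_autP ag gv fr; have [b_inj _] := fr.
have gb i : exists j, g (b i) == b j.
  have : adj v (g (b i)) by rewrite -{1}gv ag frame_adj.
  by case/(frameP fr) => j ->; exists j.
have p_inj : injective (fun i => xchoose (gb i)).
  move=> i j /(congr1 b).
  by rewrite -(eqP (xchooseP (gb i))) -(eqP (xchooseP (gb j))) => /perm_inj/b_inj.
by exists (perm p_inj) => i; rewrite permE; apply/eqP/(xchooseP (gb i)).
Qed.

Lemma nsum_ffact g x v : g \in graph_aut Gam -> nsum (ffact x g) v = nsum x (g v).
Proof.
move=> /graph_autP ag; rewrite /nsum [RHS](reindex_inj (@perm_inj _ g)).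
by apply: eq_big => u; rewrite ?inE ?ag // ffunE.
Qed.

Hypothesis ntM : nullspace Gam != [set (0%R : {ffun Gam -> 'F_2})].
Variables H G : {group {perm Gam}}.
Hypothesis sHG : H \subset G.
Hypothesis sGAut : G \subset graph_aut Gam.
Hypothesis regH : regular_on H (arcs Gam) ('P * 2).
Hypothesis regG : regular_on G (arcs2 Gam) ('P * 3).

Lemma G_aut g : g \in G -> g \in graph_aut Gam.
Proof. exact: subsetP. Qed.

Lemma H_arc v u v' u' : adj v u -> adj v' u' ->
  exists2 h, h \in H & h v = v' /\ h u = u'.
Proof.
move=> a1 a2; have [tr _] := regH.
have A1 : [tuple v; u] \in arcs Gam by rewrite inE.
have A2 : [tuple v'; u'] \in arcs Gam by rewrite inE.
have [h Hh E] := atransP2 tr A1 A2.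
by exists h => //; case: E => -> ->.
Qed.

Lemma H_arc_fix v u h : adj v u -> h \in H -> h v = v -> h u = u -> h = 1.
Proof.
move=> a1 Hh hv hu; have [_ fx] := regH.
have A1 : [tuple v; u] \in arcs Gam by rewrite inE.
apply/set1gP; rewrite -(fx _ A1) inE Hh; apply/astab1P.
by apply: val_inj; rewrite /= /aperm hv hu.
Qed.

Lemma G_arc2 x y z x' y' z' : adj x y -> adj y z -> x != z ->
  adj x' y' -> adj y' z' -> x' != z' ->
  exists2 g, g \in G & [/\ g x = x', g y = y' & g z = z'].
Proof.
move=> a1 a2 a3 c1 c2 c3; have [tr _] := regG.
have A1 : [tuple x; y; z] \in arcs2 Gam by rewrite inE /= a1 a2.
have A2 : [tuple x'; y'; z'] \in arcs2 Gam by rewrite inE /= c1 c2.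
have [h Hh E] := atransP2 tr A1 A2.
by exists h => //; case: E => -> -> ->.
Qed.

Lemma G_arc2_fix x y z g : adj x y -> adj y z -> x != z -> g \in G ->
  g x = x -> g y = y -> g z = z -> g = 1.
Proof.
move=> a1 a2 a3 Gg gx gy gz; have [_ fx] := regG.
have A1 : [tuple x; y; z] \in arcs2 Gam by rewrite inE /= a1 a2.
apply/set1gP; rewrite -(fx _ A1) inE Gg; apply/astab1P.
by apply: val_inj; rewrite /= /aperm gx gy gz.
Qed.

Lemma H_vertex v v' : exists2 h, h \in H & h v = v'.
Proof.
have [b fr] := nbhd_frame_ex v; have [b' fr'] := nbhd_frame_ex v'.
by have [h Hh [hv _]] := H_arc (frame_adj ord0 fr) (frame_adj ord0 fr'); exists h.
Qed.

(** Transitivity on 2-arcs with middle vertex [v] prescribes the images of two labels; the third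
    follows by elimination. *)
Lemma frame_perm_onto v b (p : 'S_3) : nbhd_frame v b ->
  exists2 g, g \in G & g v = v /\ forall i, g (b i) = b (p i).
Proof.
move=> fr; have [b_inj _] := fr; pose i1 : 'I_3 := lift ord0 ord0.
have a0 i : adj (b i) v by rewrite adj_sym frame_adj.
have a1 i : adj v (b i) by rewrite frame_adj.
have n01 : b ord0 != b i1 by rewrite (inj_eq b_inj).
have n01' : b (p ord0) != b (p i1) by rewrite !(inj_eq b_inj, inj_eq perm_inj).
have [g Gg [g0 gv g1]] := G_arc2 (a0 _) (a1 _) n01 (a0 _) (a1 _) n01'.
exists g => //; split=> //; have [q gq] := frame_perm (G_aut Gg) gv fr.
suff -> : p = q by [].
have q0 : q ord0 = p ord0 by apply: b_inj; rewrite -gq g0.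
have q1 : q i1 = p i1 by apply: b_inj; rewrite -gq g1.
apply/permP; apply: ord3P; rewrite ?q0 ?q1 //.
set i2 := lift _ _.
have := @card3_exhaust 'I_3 (card_ord 3) (q ord0) (q i1) (q i2) (p i2).
rewrite !(inj_eq perm_inj) => /(_ isT isT isT) /or3P[] /eqP // E.
  by move: E; rewrite q0 => /perm_inj.
by move: E; rewrite q1 => /perm_inj.
Qed.

Lemma frame_perm_inj v b g : nbhd_frame v b -> g \in G -> g v = v ->
  (forall i, g (b i) = b i) -> g = 1.
Proof.
move=> fr Gg gv gb; have [b_inj _] := fr.
apply: (@G_arc2_fix (b ord0) v (b (lift ord0 ord0))) => //.
- by rewrite adj_sym frame_adj.
- by rewrite frame_adj.
- by rewrite (inj_eq b_inj).
Qed.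

(** The stabiliser of [v] in [H] is regular on the three neighbours, so it acts there as the
    alternating group. *)
Lemma frame_parity v b g (p : 'S_3) : nbhd_frame v b -> g \in G -> g v = v ->
  (forall i, g (b i) = b (p i)) -> (g \in H) = ~~ p.
Proof.
have I3 : #|'I_3| = 3 by rewrite card_ord.
move=> fr Gg gv gb; have [b_inj _] := fr.
have Hfree h (q : 'S_3) : h \in H -> h v = v -> (forall i, h (b i) = b (q i)) ->
    q != 1 -> forall i, q i != i.
  move=> Hh hv hb q1 i; apply: contraNneq q1 => qi.
  have h1 : h = 1 by apply: (H_arc_fix (frame_adj i fr)); rewrite // hb qi.
  by apply/eqP/permP => j; apply: b_inj; rewrite -hb h1 !perm1.
have [p1|p1] := eqVneq p 1.
  have -> : g = 1 by apply: (frame_perm_inj fr) => // i; rewrite gb p1 perm1.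
  by rewrite group1 p1 odd_perm1.
apply/idP/idP => [Hg|ep].
  by apply: (perm3_free_even I3); apply: Hfree gb p1.
have pf i : p i != i by apply: contraNneq ep => /(perm3_fix_odd I3); apply.
(* [h] is the element of [H] agreeing with [g] at [v] and at the first neighbour. Both induce even
   permutations; even permutations of three points that agree at one point coincide. *)
have [h Hh [hv h0]] := H_arc (frame_adj ord0 fr) (frame_adj (p ord0) fr).
have Gh := subsetP sHG _ Hh.
have [q hb] := frame_perm (G_aut Gh) hv fr.
have q0 : q ord0 = p ord0 by apply: b_inj; rewrite -hb.
have q1 : q != 1 by apply: contraNneq (pf ord0) => q1; rewrite -q0 q1 perm1.
have eq : ~~ q by apply: (perm3_free_even I3); apply: Hfree hb q1.
have qp : q * p^-1 = 1.
  apply/eqP; apply: contraT => /(@perm3_fix_odd _ I3 _ ord0).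
  by rewrite permM q0 permK odd_permM odd_permV (negPf eq) (negPf ep) => /(_ erefl).
have pq : p = q by apply/eqP; rewrite eq_sym eq_mulgV1 qp.
suff -> : g = h by [].
apply/eqP; rewrite eq_mulgV1; apply/eqP; apply: (frame_perm_inj fr).
- by rewrite groupM ?groupV.
- by rewrite permM gv -{1}hv permK.
- by move=> i; rewrite permM gb pq -hb permK.
Qed.

(** The only case with content is that of two elements outside [H]. Multiplied by elements of [H],
    both fix a common vertex and are odd around it, so the product is even and lies in [H]. *)
Lemma notin_H_morph g g' : g \in G -> g' \in G ->
  (g * g' \notin H) = (g \notin H) (+) (g' \notin H).
Proof.
move=> Gg Gg'; have [gH|gH] := boolP (g \in H); first by rewrite groupMl.
have [gH'|gH'] := boolP (g' \in H); first by rewrite groupMr // gH.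
apply/negbTE; rewrite negbK.
(* Without vertices, [g] would be the identity. *)
have [/= v|noV] := pickP (@predT Gam); last first.
  by case/negP: gH; rewrite (_ : g = 1) ?group1 //; apply/permP => v; have := noV v.
move=> _; have [b fr] := nbhd_frame_ex v.
have [h Hh hv] := H_vertex v (g^-1 v); have [h' Hh' hv'] := H_vertex (g' v) v.
have [Gh Gh'] := (subsetP sHG _ Hh, subsetP sHG _ Hh').
have G1 : h * g \in G by rewrite groupM.
have G2 : g' * h' \in G by rewrite groupM.
have f1 : (h * g) v = v by rewrite permM hv permKV.
have f2 : (g' * h') v = v by rewrite permM hv'.
have [p pE] := frame_perm (G_aut G1) f1 fr.
have [q qE] := frame_perm (G_aut G2) f2 fr.
have op : p by rewrite -[odd_perm p]negbK -(frame_parity fr G1 f1 pE) groupMl.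
have oq : q by rewrite -[odd_perm q]negbK -(frame_parity fr G2 f2 qE) groupMr.
have : h * g * (g' * h') \in H.
  rewrite (frame_parity (p := p * q) fr) ?groupM //.
  - by rewrite odd_permM op oq.
  - by rewrite permM f1 f2.
  - by move=> i; rewrite [LHS]permM pE qE permM.
by rewrite !mulgA groupMr // -mulgA groupMl.
Qed.

Lemma card_H_cosets (v : Gam) (c : bool) : #|[set g in G | (g \notin H) == c]| = #|H|.
Proof.
case: c; last first.
  apply: eq_card => g; rewrite !inE eqbF_neg negbK.
  by apply: andb_idl; apply: subsetP.
have [b fr] := nbhd_frame_ex v.
(* An element inducing a transposition around [v] represents the second coset of [H]. *)
have [g Gg [gv gb]] := frame_perm_onto (tperm ord0 (lift ord0 ord0)) fr.
have gH : g \notin H by rewrite (frame_parity fr Gg gv gb) odd_tperm.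
rewrite -(card_lcoset H g); apply: eq_card => g'.
rewrite mem_lcoset inE eqb_id; have [Gg'|Gg'] := boolP (g' \in G); last first.
  apply/esym/negbTE; apply: contra Gg' => /(subsetP sHG).
  by rewrite groupMl ?groupV.
by rewrite -[RHS]negbK notin_H_morph ?groupV // gH /= negbK.
Qed.

Lemma nullspaceD x y : x \in nullspace Gam -> y \in nullspace Gam ->
  (x + y)%R \in nullspace Gam.
Proof.
move=> /nullspaceP x0 /nullspaceP y0; apply/nullspaceP => v.
by rewrite nsumD x0 y0 GRing.addr0.
Qed.

Lemma nullspace_ffact g x : g \in G -> x \in nullspace Gam -> ffact x g \in nullspace Gam.
Proof.
move=> Gg /nullspaceP x0; apply/nullspaceP => v.
by rewrite nsum_ffact ?G_aut.
Qed.

(** A non-zero null function is 1 at some [w]; the three values around [w] sum to 0, so one of them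
    is 0. Arc-transitivity of [H] carries this pattern to any arc. *)
Lemma nullspace_arc v u : adj v u ->
  exists2 m, m \in nullspace Gam & m v = 0%R /\ m u = 1%R.
Proof.
move=> vu.
have [x Mx x0] : exists2 x, x \in nullspace Gam & x != 0%R.
  apply/exists_inP; apply: contraR ntM; rewrite negb_exists_in => /forall_inP M0.
  rewrite eqEsubset sub1set; apply/andP; split.
    by apply/subsetP => x Mx; rewrite inE -[_ == _]negbK M0.
  apply/nullspaceP => w; rewrite /nsum big1 // => i _.
  by rewrite ffunE.
have [w /eqP xw] : exists w, x w == 1%R.
  apply/existsP; apply: contraR x0; rewrite negb_exists => /forallP x1.
  apply/eqP/ffunP => w; rewrite ffunE.
  by case: (F2P (x w)) (x1 w) => // ->; rewrite eqxx.
have [b fr] := nbhd_frame_ex w.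
have [i xi] : exists i, [ffun i => x (b i)] i = 0%R :> 'F_2.
  apply: tot0_zero; move/nullspaceP: Mx => /(_ w); rewrite (nsum_frame _ fr) => <-.
  by apply: eq_bigr => i _; rewrite ffunE.
rewrite ffunE in xi.
have [h Hh [hv hu]] : exists2 h, h \in H & h v = b i /\ h u = w.
  by apply: H_arc => //; rewrite adj_sym frame_adj.
exists (ffact x h); first by rewrite nullspace_ffact // (subsetP sHG).
by rewrite !ffunE hv hu.
Qed.

(** The null functions vanishing at [v] induce on the neighbours an additive set of vectors of total
    0, which by [nullspace_arc] is not confined to zero at any label; such a set contains every
    vector of total 0. *)
Lemma nullspace_frame v b (a : 'F_2) k : nbhd_frame v b -> tot k = 0%R ->
  exists2 m, m \in nullspace Gam & m v = a /\ forall i, m (b i) = k i.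
Proof.
move=> fr; pose rs (m : {ffun Gam -> 'F_2}) : {ffun 'I_3 -> 'F_2} := [ffun i => m (b i)].
have rs0 m : m \in nullspace Gam -> tot (rs m) = 0%R.
  move=> /nullspaceP/(_ v); rewrite (nsum_frame _ fr) => <-.
  by apply: eq_bigr => i _; rewrite ffunE.
have rsD m m' : rs (m + m')%R = (rs m + rs m')%R by apply/ffunP => i; rewrite !ffunE.
pose good k := exists m, [/\ m \in nullspace Gam, m v = 0%R & rs m = k].
have goodD k1 k2 : good k1 -> good k2 -> good (k1 + k2)%R.
  move=> [m1 [M1 v1 <-]] [m2 [M2 v2 <-]]; exists (m1 + m2)%R.
  by rewrite nullspaceD // ffunE v1 v2 GRing.addr0 rsD.
have good1 i : exists2 k, good k & k i = 1%R.
  have [m Mm [mv mi]] := nullspace_arc (frame_adj i fr).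
  by exists (rs m); [exists m | rewrite ffunE].
have good_tot k1 : good k1 -> tot k1 = 0%R by move=> [m [Mm _ <-]]; apply: rs0.
have all_good k1 : tot k1 = 0%R -> good k1.
  move=> k10; have [->|k1n] := eqVneq k1 0%R.
    have [k2 g2 _] := good1 ord0; rewrite -(addF2ffun k2); exact: goodD.
  have neq0 (l : {ffun 'I_3 -> 'F_2}) i : l i = 1%R -> l != 0%R.
    by move=> li; apply/eqP => l0; move: li; rewrite l0 ffunE.
  have [j k1j] := tot0_zero k10.
  (* Nonzero vectors of total 0 are determined by their unique zero, so k1 is k3
     or k2 + k3. *)
  have [k2 g2 k2j] := good1 j; have k20 := good_tot _ g2.
  have [j2 k2j2] := tot0_zero k20.
  have [k3 g3 k3j2] := good1 j2; have k30 := good_tot _ g3.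
  have k2n := neq0 _ _ k2j; have k3n := neq0 _ _ k3j2.
  case: (F2P (k3 j)) => k3j; first by rewrite (tot0_eq k10 k30 k1n k3n k1j k3j).
  have -> : k1 = (k2 + k3)%R; last exact: goodD.
  apply: (tot0_eq (j := j)) => //.
  - by rewrite totD k20 k30 GRing.addr0.
  - by apply: (neq0 _ j2); rewrite ffunE k2j2 k3j2 GRing.add0r.
  - by rewrite ffunE k2j k3j addF2.
move=> k0.
(* [m0] supplies the value at [v]; [m1], vanishing at [v], then corrects the values on the
   neighbours. *)
have [m0 M0 m0v] : exists2 m, m \in nullspace Gam & m v = a.
  case: (F2P a) => ->.
    by have [m [Mm mv _]] := all_good _ tot0; exists m.
  have [m Mm [_ mv]] := @nullspace_arc (b ord0) v (etrans (adj_sym _ _) (frame_adj _ fr)).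
  by exists m.
have [m1 [M1 m1v m1k]] : good (k + rs m0)%R.
  by apply: all_good; rewrite totD k0 rs0 // GRing.addr0.
exists (m0 + m1)%R; first exact: nullspaceD.
split=> [|i]; first by rewrite ffunE m0v m1v GRing.addr0.
move/ffunP: m1k => /(_ i); rewrite !ffunE => ->.
by rewrite GRing.addrCA addF2 GRing.addr0.
Qed.

(** A constant function supplies the total of [k]; the null function added to it takes the same
    value at [v], so the sum vanishes there. This lifts local shifts into a vertex stabiliser. *)
Lemma nsum_const_frame v b k : nbhd_frame v b -> exists x : {ffun Gam -> 'F_2},
  [/\ forall w, nsum x w = tot k, x v = 0%R & forall i, x (b i) = k i].
Proof.
move=> fr; pose a := tot k.
have tc : tot [ffun=> a] = a by rewrite totE !ffunE addF2 GRing.add0r.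
have k0 : tot (k + [ffun=> a])%R = 0%R by rewrite totD tc addF2.
have [m /nullspaceP Mm [mv mb]] := nullspace_frame a fr k0.
exists (m + [ffun=> a])%R; split=> [w||i].
- by rewrite nsumD Mm nsum_const GRing.add0r.
- by rewrite !ffunE mv addF2.
- by rewrite !ffunE mb !ffunE -GRing.addrA addF2 GRing.addr0.
Qed.

(** * The lifted group on the lexicographic product *)

Section LiftedGroup.

Variables (S : {set 'F_2 * bool}) (v0 : Gam).
Hypothesis S0 : (0%R, false) \in S.
Hypothesis SD : forall (a b : 'F_2) c d,
  (a, c) \in S -> (b, d) \in S -> ((a + b)%R, c (+) d) \in S.

(** The span of the nullspace and the constant functions; [v0] is a base vertex at which the common
    sum is read. *)
Definition constsum : {set {ffun Gam -> 'F_2}} :=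
  [set x | [forall v, nsum x v == nsum x v0]].

Lemma constsumP x : reflect (forall v, nsum x v = nsum x v0) (x \in constsum).
Proof. by rewrite inE; apply: (iffP forallP) => E v; apply/eqP/E. Qed.

Definition lift_pairs : {set {ffun Gam -> 'F_2} * {perm Gam}} :=
  [set q | [&& q.1 \in constsum, q.2 \in G & (nsum q.1 v0, q.2 \notin H) \in S]].

Definition lift_set : {set {perm lex2 Gam}} := [set wr q.1 q.2 | q in lift_pairs].

Lemma lift_setP (c : {perm lex2 Gam}) :
  reflect (exists x g, [/\ x \in constsum, g \in G,
             (nsum x v0, g \notin H) \in S & c = wr x g]) (c \in lift_set).
Proof.
apply: (iffP imsetP) => [[[x g]]|[x [g [x1 g1 s1 ->]]]].
  by rewrite inE => /and3P[/= x1 g1 s1] ->; exists x, g.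
by exists (x, g); rewrite // inE x1 g1 s1.
Qed.

(** Pulling back along an automorphism keeps a common sum, and [notin_H_morph] handles the second
    component, so products of lifts correspond to sums in [S]. *)
Lemma lift_group_set : group_set lift_set.
Proof.
apply/group_setP; split.
  have n0 v : nsum (0%R : {ffun Gam -> 'F_2}) v = 0%R.
    by rewrite /nsum big1 // => u _; rewrite ffunE.
  apply/lift_setP; exists 0%R, 1; split; last exact: wr1.
  - by apply/constsumP => v; rewrite !n0.
  - exact: group1.
  - by rewrite n0 group1.
move=> c d /lift_setP[x [g [/constsumP x1 g1 s1 ->]]].
move=> /lift_setP[y [h [/constsumP y1 h1 s2 ->]]].
have nE v : nsum (x + ffact y g)%R v = (nsum x v0 + nsum y v0)%R.
  by rewrite nsumD x1 nsum_ffact ?G_aut // y1.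
apply/lift_setP; exists (x + ffact y g)%R, (g * h); split; last exact: wrM.
- by apply/constsumP => v; rewrite !nE.
- exact: groupM.
- by rewrite nE notin_H_morph //; apply: SD.
Qed.

Definition lift_group := Group lift_group_set.

(** These elements have image [(0, false)], so they are present for every [S]; they already give
    arc-transitivity. *)
Lemma mem_lift_nullspace m h : m \in nullspace Gam -> h \in H -> wr m h \in lift_group.
Proof.
move=> /nullspaceP Mm Hh; apply/lift_setP; exists m, h; split=> //.
- by apply/constsumP => v; rewrite !Mm.
- exact: subsetP Hh.
- by rewrite Mm Hh.
Qed.

Lemma lift_group_aut : lift_group \subset graph_aut (lex2 Gam).
Proof.
apply/subsetP => _ /lift_setP[x [g [_ Gg _ ->]]]; rewrite inE.
apply/'forall_forallP => -[a v] [b u]; rewrite !wrE /= /lex2_adj /=.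
by rewrite graph_autP ?G_aut.
Qed.

Lemma lift_group_arc_transitive : arc_transitive lift_group.
Proof.
have [b fr] := nbhd_frame_ex v0.
have a0 : [tuple (0%R, v0) : lex2 Gam; (0%R, b ord0)] \in arcs (lex2 Gam).
  by rewrite inE; apply: frame_adj.
apply/imsetP; eexists; first exact: a0.
apply/setP => t; apply/idP/orbitP => [|[c Cc <-]]; last first.
  have ac := graph_autP (subsetP lift_group_aut c Cc).
  by move: a0; rewrite !inE => a0; apply: etrans (ac _ _) a0.
case: t => -[|[a v] [|[a' u] []]] //= st; rewrite inE => /= vu.
have [h Hh [hv hu]] := H_arc (frame_adj ord0 fr) (vu : adj v u).
(* Giving [a'] to two of the three labels keeps the total 0 and puts the required shift at the first
   neighbour. *)
pose k : {ffun 'I_3 -> 'F_2} := 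
  [ffun i => if i == lift ord0 (lift ord0 ord0) then 0%R else a'].
have k0 : tot k = 0%R by rewrite totE !ffunE /= addF2 GRing.addr0.
have [m Mm [mv mb]] := nullspace_frame a fr k0.
exists (wr m h); first exact: mem_lift_nullspace.
by apply: val_inj; rewrite /= /aperm !wrE !GRing.add0r mv hv hu mb ffunE.
Qed.

Lemma card_lift_group : #|lift_group| = (#|nullspace Gam| * #|H| * #|S|)%N.
Proof.
have cA a : #|[set x in constsum | nsum x v0 == a]| = #|nullspace Gam|.
  (* Translation by the constant [a] maps the nullspace onto the fibre over [a]. *)
  rewrite -[RHS](card_imset _ (@GRing.addIr _ ([ffun=> a] : {ffun Gam -> 'F_2}))).
  apply: eq_card => x; rewrite inE; apply/andP/imsetP.
    case=> /constsumP x1 /eqP xa; exists (x + [ffun=> a])%R.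
      by apply/nullspaceP => v; rewrite nsumD nsum_const x1 xa addF2.
    by rewrite -GRing.addrA addF2ffun GRing.addr0.
  case=> m /nullspaceP Mm ->; have mE v : nsum (m + [ffun=> a])%R v = a.
    by rewrite nsumD nsum_const Mm GRing.add0r.
  by split; [apply/constsumP => v | ]; rewrite !mE.
rewrite -(card_fibre_pairs S cA (card_H_cosets v0)).
rewrite -(@card_in_imset _ _ (fun q => wr q.1 q.2)) //.
by move=> [x g] [y h] _ _ /= /wr_inj[-> ->].
Qed.

Lemma card_arcs : #|arcs Gam| = #|H|.
Proof.
have [tr fx] := regH; have [b fr] := nbhd_frame_ex v0.
have a0 : [tuple v0; b ord0] \in arcs Gam by rewrite inE; apply: frame_adj.
rewrite -(card_orbit_stab ('P * 2) H [tuple v0; b ord0]) (atransP tr _ a0).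
by rewrite fx // cards1 muln1.
Qed.

Lemma card_arcs_lex2 : #|arcs (lex2 Gam)| = (4 * #|arcs Gam|)%N.
Proof.
pose f (q : ('F_2 * 'F_2) * 2.-tuple Gam) : 2.-tuple (lex2 Gam) :=
  [tuple (q.1.1, tnth q.2 ord0); (q.1.2, tnth q.2 ord_max)].
have f_inj : injective f.
  move=> [[a b] t] [[a' b'] t'] [-> E1 -> E2]; congr pair.
  apply: eq_from_tnth => i; case: (unliftP ord0 i) => [j|] -> //.
  rewrite (ord1 j).
  by have -> : lift ord0 ord0 = ord_max :> 'I_2 by apply: val_inj.
have -> : arcs (lex2 Gam) = f @: setX setT (arcs Gam).
  apply/setP => t; apply/idP/imsetP.
    case: t => -[|[a v] [|[a' u] []]] //= st; rewrite inE => /= vu.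
    exists ((a, a'), [tuple v; u]); first by rewrite !inE.
    exact: val_inj.
  case=> -[[a a'] t'] + ->; rewrite !inE /=.
  by case: t' => -[|v [|u []]].
by rewrite card_imset // cardsX cardsT card_prod card_Fp.
Qed.

(** Orbit-stabiliser: the product has four arcs over each of the [#|H|] arcs of [Gam], and the
    factor [#|H|] cancels. *)
Lemma card_lift_arc_stab t : t \in arcs (lex2 Gam) ->
  (#|'C_lift_group[t | 'P * 2]| * 4 = #|nullspace Gam| * #|S|)%N.
Proof.
move=> At; have := card_orbit_stab ('P * 2) lift_group t.
rewrite (atransP lift_group_arc_transitive _ At) card_arcs_lex2 card_arcs.
rewrite card_lift_group.
move=> E; apply/eqP; rewrite -(eqn_pmul2r (cardG_gt0 H)); apply/eqP.
by rewrite -mulnA mulnC E mulnAC.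
Qed.

(** A frame at [v] turns the coordinates [e] into labels for the neighbours of [vv]. There the total
    of the induced shift is the common sum, and the sign decides membership in [H], so the local and
    global conditions on [S] agree. *)
Lemma lift_group_local (X : finType) (L : {group {perm X}})
    (e : X -> 'F_2 * 'I_3) (vv : lex2 Gam) :
  bijective e ->
  (forall l, l \in L -> exists k (p : 'S_3),
     (tot k, odd_perm p) \in S /\ forall z, e (l z) = wr k p (e z)) ->
  (forall k (p : 'S_3), (tot k, odd_perm p) \in S ->
     exists2 l, l \in L & forall z, e (l z) = wr k p (e z)) ->
  perm_isomorphic L [set: X] (local_group lift_group vv) (nbhd vv).
Proof.
case: vv => [a v] [e' eK e'K] LS SL.
have [b fr] := nbhd_frame_ex v; have [b_inj _] := fr.
pose f (w : X) : lex2 Gam := ((e w).1, b (e w).2).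
have stepE (l : {perm X}) k p (x : {ffun Gam -> 'F_2}) (g : {perm Gam}) :
    (forall z, e (l z) = wr k p (e z)) ->
    (forall i, g (b i) = b (p i)) -> (forall i, x (b i) = k i) ->
    forall z, wr x g (f z) = f (l z).
  by move=> le gb xb w; rewrite /f le; case: (e w) => c i; rewrite !wrE gb xb.
apply: (@local_group_isomorphic _ _ _ _ _ f).
- move=> w w' /eqP; rewrite xpair_eqE => /andP[/eqP E1 /eqP/b_inj E2].
  by apply: (can_inj eK); rewrite [LHS]surjective_pairing E1 E2 -surjective_pairing.
- apply/setP => -[c u]; rewrite [RHS]inE; apply/imsetP/idP.
    by case=> w _ [_ ->]; apply: frame_adj.
  rewrite /= => /(frameP fr)[i /= ->]; exists (e' (c, i)); first by rewrite inE.
  by rewrite /f e'K.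
- move=> l /LS[k [p [Skp le]]].
  have [x [xc xv xb]] := nsum_const_frame k fr.
  have [g Gg [gv gb]] := frame_perm_onto p fr.
  exists (wr x g); last exact: stepE le gb xb.
  rewrite inE; apply/andP; split.
    apply/lift_setP; exists x, g; split=> //; first by apply/constsumP => w; rewrite !xc.
    by rewrite xc (frame_parity fr Gg gv gb) negbK.
  by apply/astab1P; rewrite /= /aperm wrE xv gv GRing.addr0.
- move=> c /setIP[/lift_setP[x [g [/constsumP xc Gg Sxg ->]]] /astab1P].
  rewrite /= /aperm wrE => /eqP; rewrite xpair_eqE => /andP[_ /eqP gv].
  have [p gb] := frame_perm (G_aut Gg) gv fr.
  pose k : {ffun 'I_3 -> 'F_2} := [ffun i => x (b i)].
  have kE : tot k = nsum x v0.
    by rewrite -(xc v) (nsum_frame _ fr); apply: eq_bigr => i _; rewrite ffunE.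
  have [|l Ll le] := SL k p.
    by rewrite kE -[odd_perm p]negbK -(frame_parity fr Gg gv gb).
  exists l => //; apply: stepE le gb _ => i.
  by rewrite ffunE.
Qed.

End LiftedGroup.

End CubicGraph.

Theorem theorem5p3
  (Omega : finType) (L : {group {perm Omega}})
  (degL : #|Omega| = 6)
  (transL : [transitive L, on [set: Omega] | 'P])
  (imprimL : ~~ [primitive L, on [set: Omega] | 'P])
  (noblock3 : forall B : {set Omega}, block L B -> #|B| <> 3)
  (Gam : sgraph) (connGam : connected Gam) (cubicGam : cubic Gam)
  (ntM : nullspace Gam != [set (0%R : {ffun Gam -> 'F_2})])
  (H G : {group {perm Gam}})
  (sHG : H \subset G) (sGAut : G \subset graph_aut Gam)
  (regH : regular_on H (arcs Gam) ('P * 2))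
  (regG : regular_on G (arcs2 Gam) ('P * 3)) :
  let M := nullspace Gam in
  let Lam := lex2 Gam in
  exists C : {group {perm Lam}},
    [/\ C \subset graph_aut Lam,
        arc_transitive C,
        locally L C,
        forall a, a \in arcs Lam ->
          (#|'C_C[a | 'P * 2]|%:R = #|M|%:R * #|L|%:R / 48%:R :> rat)%R
      & (#|M|%:R / 4%:R <= #|M|%:R * #|L|%:R / 48%:R :> rat)%R].
Proof.
have [e [S [e_bij S0 SD [LS SL] cL]]] :=
  imprimitive_classification degL transL imprimL noblock3.
have [/card_gt0P[v0 _] _] := connGam.
(* The order of [L] is 12 times that of [S], and 12/48 is 1/4. *)
have cLM m : (m * #|L|%:R / 48%:R = m * #|S|%:R / 4%:R :> rat)%R.
  rewrite cL GRing.natrM GRing.mulrA GRing.mulrAC [RHS]GRing.mulrAC; congr (_ * _)%R.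
  by rewrite -GRing.mulrA; congr (_ * _)%R.
exists (lift_group cubicGam sHG sGAut regH regG v0 S0 SD).
have sA := lift_group_aut cubicGam sHG sGAut regH regG v0 S0 SD.
have aT := lift_group_arc_transitive cubicGam ntM sHG sGAut regH regG v0 S0 SD.
split=> //.
- by split=> // vv; apply: lift_group_local e_bij LS SL.
- move=> a Aa; rewrite cLM -GRing.natrM.
  rewrite -(card_lift_arc_stab cubicGam ntM sHG sGAut regH regG v0 S0 SD Aa).
  by rewrite GRing.natrM GRing.mulfK.
(* The bound amounts to [S] having at least one element, namely [(0, false)]. *)
rewrite cLM -GRing.mulrA Num.Theory.ler_wpM2l ?Num.Theory.ler0n //.
rewrite Num.Theory.ler_peMl //.
by rewrite Num.Theory.ler1n; apply/card_gt0P; exists (0%R, false).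
Qed.
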